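(* For every $n\ge 0$ there is an involution $\Phi$ on the set of tip-augmented plane trees with $n$ edges such that for every such tree $T$: the number of singleton leaves of $\Phi(T)$ equals the number of elder non-twin leaves of $T$, the number of elder non-twin leaves of $\Phi(T)$ equals the number of singleton leaves of $T$, and $\Phi(T)$ and $T$ have the same numbers of elder twin leaves, of second leaves, and of younger leaves.
   Context: A plane tree is a rooted tree in which the children of each vertex are linearly ordered (left to right). A leaf is a non-root vertex with no children; an interior vertex is a vertex with at least one child. A tip-augmented plane tree is a plane tree in which the leftmost child of every interior vertex is a leaf. Leaves are classified: a singleton leaf is a leaf with no siblings; an elder twin leaf is a leaf that is the leftmost child of its parent and the second child of that parent is also a leaf; an elder non-twin leaf is a leaf that is the leftmost child of its parent and the second child of that parent is not a leaf; a second leaf is a leaf that is the second child of its parent; a younger leaf is a leaf that is neither the first nor the second child of its parent.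
   Formalization: The case n = 1 is excluded, because the only tip-augmented plane tree with one edge has one singleton leaf and no elder non-twin leaf, so the claimed involution cannot exist there. *)

(* Defs.v *)
(* MathComp. *)
From mathcomp Require Import all_boot.
Set Implicit Arguments.
Unset Strict Implicit.
Unset Printing Implicit Defensive.

(* A vertex is its ordered list of child subtrees, leftmost child first. *)
Inductive plane_tree : Type := Node of seq plane_tree.

Definition children (t : plane_tree) : seq plane_tree := let: Node ts := t in ts.

(* One entry per vertex of t, in preorder: the subtree hanging from that vertex. *)
Fixpoint vertices (t : plane_tree) : seq plane_tree :=
  let: Node ts := t in t :: flatten (map vertices ts).

(* Every edge is counted at its upper endpoint. *)
Definition num_edges (t : plane_tree) : nat :=
  \sum_(v <- vertices t) size (children v).

(* A non-root vertex is addressed by the list ch of the children of its parent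
   and its 0-based position i in ch; so the root of the tree is never a leaf. *)
Definition leaf_at (ch : seq plane_tree) (i : nat) : bool :=
  (i < size ch) && nilp (children (nth (Node [::]) ch i)).

Definition tip_augmented (t : plane_tree) : bool :=
  all (fun v => (0 < size (children v)) ==> leaf_at (children v) 0) (vertices t).

Definition singleton_leaf (ch : seq plane_tree) (i : nat) : bool :=
  leaf_at ch i && (size ch == 1).

Definition elder_twin_leaf (ch : seq plane_tree) (i : nat) : bool :=
  [&& leaf_at ch i, i == 0 & leaf_at ch 1].

(* The second child is required to exist, so a singleton leaf is not elder. *)
Definition elder_non_twin_leaf (ch : seq plane_tree) (i : nat) : bool :=
  [&& leaf_at ch i, i == 0, 1 < size ch & ~~ leaf_at ch 1].

Definition second_leaf (ch : seq plane_tree) (i : nat) : bool :=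
  leaf_at ch i && (i == 1).

Definition younger_leaf (ch : seq plane_tree) (i : nat) : bool :=
  leaf_at ch i && (1 < i).

Definition num_leaves (P : seq plane_tree -> nat -> bool) (t : plane_tree) : nat :=
  \sum_(v <- vertices t) count (P (children v)) (iota 0 (size (children v))).

Definition tip_tree (n : nat) : Type :=
  {t : plane_tree | tip_augmented t && (num_edges t == n)}.

(* For n = 1 no involution exchanging singleton leaves and elder non-twin leaves
   exists: the only tree is a root with one child, which has one singleton leaf
   and no elder non-twin leaf.  The main statement therefore excludes n = 1. *)

(* Main.v *)
(* Call a tip-augmented tree large if its root has at least two children.  A
   large tree is, uniquely, either a root with exactly two children, or a large
   tree to whose root a rightmost child has been added.  As every non-root
   subtree is a leaf, a cherry (one edge) or large, the generating function J of
   large trees satisfies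
     J = z^2 t w + z^3 x y + z^2 (x + y) J + z u J + z J^2,
   where z marks edges and x, y, t, w, u mark singleton, elder non-twin, elder
   twin, second and younger leaves.  The equation is symmetric in x and y, and
   exchanging the terms z^2 x J and z^2 y J recursively gives the involution. *)
Require Import Defs.
From mathcomp Require Import all_boot.

Set Implicit Arguments.
Unset Strict Implicit.
Unset Printing Implicit Defensive.

(** * Induction on plane trees and sums over their vertices *)

Notation leaf := (Node [::]).
Notation cherry := (Node [:: leaf]).

(** The [foldr] conjunction gives one hypothesis per child and unfolds by computation along the list
    of children. *)
Fixpoint plane_tree_nested_ind (P : plane_tree -> Prop)
    (IH : forall t, foldr (fun c => and (P c)) True (children t) -> P t)
    (t : plane_tree) : P t :=
  let: Node ts := t in
  IH (Node ts) ((fix loop ts : foldr (fun c => and (P c)) True ts :=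
    if ts is c :: ts' then conj (plane_tree_nested_ind IH c) (loop ts')
    else I) ts).

(** Both [num_edges] and every [num_leaves P] are instances up to conversion, so one argument treats
    all the statistics. *)
Definition vertex_sum (F : seq plane_tree -> nat) (t : plane_tree) : nat :=
  \sum_(v <- vertices t) F (children v).

Lemma vertex_sum_Node F ts :
  vertex_sum F (Node ts) = F ts + \sum_(t <- ts) vertex_sum F t.
Proof.
by rewrite /vertex_sum /= big_cons big_flatten /= big_map.
Qed.

Lemma vertex_sum_leaf F : vertex_sum F leaf = F [::].
Proof. by rewrite vertex_sum_Node big_nil addn0. Qed.

Lemma tip_augmented_Node ts :
  tip_augmented (Node ts) =
  ((0 < size ts) ==> leaf_at ts 0) && all tip_augmented ts.
Proof.
rewrite /tip_augmented /=; congr (_ && _).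
by elim: ts => //= t ts <-; rewrite all_cat.
Qed.

Definition large (t : plane_tree) : bool := 1 < size (children t).

Variant tip_augmented_spec : plane_tree -> Prop :=
  | TipLeaf : tip_augmented_spec leaf
  | TipCherry : tip_augmented_spec cherry
  | TipLarge c ts of tip_augmented c & all tip_augmented ts :
      tip_augmented_spec (Node [:: leaf, c & ts]).

Lemma tip_augmentedP t : tip_augmented t -> tip_augmented_spec t.
Proof.
case: t => -[|[[|//]] [|c ts]]; rewrite tip_augmented_Node; try by constructor.
by case/andP=> _ /= /andP[c_tip ts_tip]; constructor.
Qed.

Definition add_child (t c : plane_tree) : plane_tree :=
  Node (rcons (children t) c).

Lemma vertex_sum_add_child F d t c :
    (forall ts, 1 < size ts -> F (rcons ts c) = F ts + d) -> large t ->
  vertex_sum F (add_child t c) = vertex_sum F t + d + vertex_sum F c.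
Proof.
case: t => ts Fd ts_large; rewrite !vertex_sum_Node Fd // -cats1 big_cat.
by rewrite big_seq1 /= !addnA (addnAC _ d).
Qed.

Lemma tip_augmented_add_child t c :
  large t -> tip_augmented t -> tip_augmented c -> tip_augmented (add_child t c).
Proof.
case: t => -[|t0 ts] //= _; rewrite !tip_augmented_Node /= all_rcons.
by case/and3P=> *; apply/and4P.
Qed.

(** * Codes for large tip-augmented trees *)

(** One constructor for each monomial of the equation for J: [LeafLarge] is z^2 y J and [AddCherry]
    is z^2 x J. *)
Inductive code : Type :=
  | Twin
  | LeafCherry
  | LeafLarge of code
  | AddLeaf of code
  | AddCherry of code
  | AddLarge of code & code.

Fixpoint decode (b : code) : plane_tree :=
  match b with
  | Twin => Node [:: leaf; leaf]
  | LeafCherry => Node [:: leaf; cherry]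
  | LeafLarge b => Node [:: leaf; decode b]
  | AddLeaf b => add_child (decode b) leaf
  | AddCherry b => add_child (decode b) cherry
  | AddLarge a b => add_child (decode a) (decode b)
  end.

(* In the next two definitions [e] is the code of [c], relevant if [c] is large. *)
Definition encode_pair (c : plane_tree) (e : code) : code :=
  match children c with
  | [::] => Twin
  | [:: _] => LeafCherry
  | _ => LeafLarge e
  end.

Definition encode_add (b : code) (c : plane_tree) (e : code) : code :=
  match children c with
  | [::] => AddLeaf b
  | [:: _] => AddCherry b
  | _ => AddLarge b e
  end.

(* The value [Twin] on trees that are not large is junk. *)
Fixpoint encode (t : plane_tree) : code :=
  if t is Node [:: _, c & ts] then
    foldl (fun b c => encode_add b c (encode c)) (encode_pair c (encode c)) ts
  else Twin.

Lemma decode_large b : large (decode b).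
Proof.
by elim: b => //= [b|b|a] IH *; rewrite /large /= size_rcons ltnW.
Qed.

Lemma tip_augmented_decode b : tip_augmented (decode b).
Proof.
elim: b => //= [b IH|b IH|b IH|a IHa b IHb].
- by rewrite tip_augmented_Node /= IH.
- exact: tip_augmented_add_child (decode_large b) IH _.
- exact: tip_augmented_add_child (decode_large b) IH _.
- exact: tip_augmented_add_child (decode_large a) IHa IHb.
Qed.

Lemma encode_add_child t c :
  large t -> encode (add_child t c) = encode_add (encode t) c (encode c).
Proof. by case: t => -[|t0 [|t1 ts]] //= _; rewrite foldl_rcons. Qed.

(** Every decoded subtree is large, so it is never mistaken for a leaf or a cherry. *)
Lemma decodeK : cancel decode encode.
Proof.
have pair_large e c : large c -> encode_pair c e = LeafLarge e.
  by case: c => -[|? []].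
have add_large b e c : large c -> encode_add b c e = AddLarge b e.
  by case: c => -[|? []].
elim=> // [b IH|b IH|b IH|a IHa b IHb]; rewrite [decode _]/=.
- by rewrite /= pair_large ?IH ?decode_large.
- by rewrite encode_add_child ?IH ?decode_large.
- by rewrite encode_add_child ?IH ?decode_large.
- by rewrite encode_add_child ?add_large ?IHa ?IHb ?decode_large.
Qed.

Lemma encodeK t : tip_augmented t -> large t -> decode (encode t) = t.
Proof.
elim/plane_tree_nested_ind: t => t + t_tip.
case/tip_augmentedP: t_tip => // c ts c_tip ts_tip [_ [IHc IHts]] _ /=.
(* Generalized over the accumulator: [b] codes the root with the children [s] read so far. *)
suff fold s b : decode b = Node s ->
    decode (foldl (fun b c => encode_add b c (encode c)) b ts) = Node (s ++ ts).
  apply: (fold [:: leaf; c]).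
  by case/tip_augmentedP: c_tip (IHc c_tip) => // c' s _ _ /= ->.
elim: ts s b ts_tip IHts => [|c' ts IH] s b; first by rewrite cats0.
case/andP=> c'_tip ts_tip [IHc' IHts] /= bE.
rewrite -cat_rcons; apply: IH => //.
suff -> : decode (encode_add b c' (encode c')) = add_child (decode b) c'.
  by rewrite bE.
(* Leaves and cherries have their own constructors; only a large child needs the induction
   hypothesis. *)
by case/tip_augmentedP: c'_tip (IHc' c'_tip) => // c1 s1 _ _ /= ->.
Qed.

(** * The involution on codes *)

Fixpoint swap (b : code) : code :=
  match b with
  | Twin => Twin
  | LeafCherry => LeafCherry
  | LeafLarge b => AddCherry (swap b)
  | AddLeaf b => AddLeaf (swap b)
  | AddCherry b => LeafLarge (swap b)
  | AddLarge a b => AddLarge (swap a) (swap b)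
  end.

Lemma swapK : involutive swap.
Proof. by elim=> //= [b ->|b ->|b ->|a -> b ->]. Qed.

(* [d] is the contribution of a new rightmost child, by whether it is a leaf; the
   last two hypotheses compare [LeafLarge] with [AddCherry], the extra cherry
   contributing its own term at [:: leaf]. *)
Lemma vertex_sum_swap F G (d : bool -> nat) b :
    F [::] = 0 -> G [::] = 0 -> F [:: leaf; leaf] = G [:: leaf; leaf] ->
    (forall ts c, 1 < size ts -> F (rcons ts c) = F ts + d (nilp (children c))) ->
    (forall ts c, 1 < size ts -> G (rcons ts c) = G ts + d (nilp (children c))) ->
    (forall c, 0 < size (children c) ->
      F [:: leaf; c] = d false + G [:: leaf]) ->
    (forall c, 0 < size (children c) ->
      G [:: leaf; c] = d false + F [:: leaf]) ->
  vertex_sum G (decode (swap b)) = vertex_sum F (decode b).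
Proof.
move=> F0 G0 FG2 Fadd Gadd FG GF.
have addF t c := vertex_sum_add_child (t := t) (fun ts => @Fadd ts c).
have addG t c := vertex_sum_add_child (t := t) (fun ts => @Gadd ts c).
have Fleaf : vertex_sum F leaf = 0 by rewrite vertex_sum_leaf.
have Gleaf : vertex_sum G leaf = 0 by rewrite vertex_sum_leaf.
have Fcherry : vertex_sum F cherry = F [:: leaf].
  by rewrite vertex_sum_Node big_seq1 Fleaf addn0.
have Gcherry : vertex_sum G cherry = G [:: leaf].
  by rewrite vertex_sum_Node big_seq1 Gleaf addn0.
have pairF c : vertex_sum F (Node [:: leaf; c]) = F [:: leaf; c] + vertex_sum F c.
  by rewrite vertex_sum_Node big_cons big_seq1 Fleaf.
have pairG c : vertex_sum G (Node [:: leaf; c]) = G [:: leaf; c] + vertex_sum G c.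
  by rewrite vertex_sum_Node big_cons big_seq1 Gleaf.
have pos e : 0 < size (children (decode e)) by apply/ltnW/decode_large.
have interior e : nilp (children (decode e)) = false.
  by rewrite /nilp -leqn0 leqNgt pos.
elim: b => [||b IH|b IH|b IH|a IHa b IHb] /=.
- by rewrite pairF pairG FG2 Fleaf Gleaf.
(* The monomial z^3 x y is symmetric: both sides are [d false + F [:: leaf] + G [:: leaf]] up to
   order. *)
- by rewrite pairF pairG Fcherry Gcherry FG // GF // addnAC.
- by rewrite pairF addG ?decode_large // IH FG // Gcherry -addnA addnC.
- by rewrite addF ?addG ?decode_large // IH Fleaf Gleaf.
- by rewrite pairG addF ?decode_large // IH GF // Fcherry addnC addnA.
- by rewrite addF ?addG ?decode_large // !interior IHa IHb.
Qed.

(** * Leaf counts at a single vertex *)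

Definition leaf_count (P : seq plane_tree -> nat -> bool) (ts : seq plane_tree) :=
  count (P ts) (iota 0 (size ts)).

Lemma leaf_count_rcons P ts c :
    (forall i, i < size ts -> P (rcons ts c) i = P ts i) ->
  leaf_count P (rcons ts c) = leaf_count P ts + P (rcons ts c) (size ts).
Proof.
move=> Pi; rewrite /leaf_count size_rcons -addn1 iotaD count_cat /= add0n addn0.
congr (_ + _); apply: eq_in_count => i; rewrite mem_iota => /andP[_ lt_i].
exact: Pi.
Qed.

Lemma leaf_at_rcons ts c i :
  i < size ts -> leaf_at (rcons ts c) i = leaf_at ts i.
Proof.
by move=> lt_i; rewrite /leaf_at nth_rcons size_rcons lt_i ltnW.
Qed.

Lemma leaf_at_last ts c : leaf_at (rcons ts c) (size ts) = nilp (children c).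
Proof. by rewrite /leaf_at nth_rcons size_rcons ltnn eqxx leqnn. Qed.

(** * The involution on trees and its effect on the statistics *)

Definition tree_swap (t : plane_tree) : plane_tree :=
  if large t then decode (swap (encode t)) else t.

Lemma tree_swapK t : tip_augmented t -> tree_swap (tree_swap t) = t.
Proof.
rewrite /tree_swap => t_tip; case t_large: (large t); last by rewrite t_large.
by rewrite decode_large decodeK swapK encodeK.
Qed.

Lemma tip_augmented_tree_swap t :
  tip_augmented t -> tip_augmented (tree_swap t).
Proof. by rewrite /tree_swap; case: ifP; rewrite ?tip_augmented_decode. Qed.

Lemma vertex_sum_tree_swap F G (d : bool -> nat) t :
    F [::] = 0 -> G [::] = 0 -> F [:: leaf; leaf] = G [:: leaf; leaf] ->
    (forall ts c, 1 < size ts -> F (rcons ts c) = F ts + d (nilp (children c))) ->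
    (forall ts c, 1 < size ts -> G (rcons ts c) = G ts + d (nilp (children c))) ->
    (forall c, 0 < size (children c) ->
      F [:: leaf; c] = d false + G [:: leaf]) ->
    (forall c, 0 < size (children c) ->
      G [:: leaf; c] = d false + F [:: leaf]) ->
    tip_augmented t -> num_edges t <> 1 ->
  vertex_sum G (tree_swap t) = vertex_sum F t.
Proof.
move=> F0 G0 FG2 Fadd Gadd FG GF t_tip.
have [t_large _|] := boolP (large t).
  rewrite /tree_swap t_large -{2}(encodeK t_tip t_large).
  exact: (vertex_sum_swap (d := d)).
rewrite /tree_swap; case/tip_augmentedP: t_tip => //= _.
  by rewrite !vertex_sum_leaf F0 G0.
(* The cherry is the one tree with a single edge, where [F] and [G] may differ. *)
by case; rewrite /num_edges /= !big_cons big_nil.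
Qed.

Lemma num_edges_tree_swap t :
  tip_augmented t -> num_edges t <> 1 -> num_edges (tree_swap t) = num_edges t.
Proof.
(* Here [F] and [G] are both [size]: any new child adds one edge. *)
apply: (vertex_sum_tree_swap (d := fun=> 1)) => // ts c _;
  by rewrite size_rcons addn1.
Qed.

(* The summand [+ 0] below is [d _] of [vertex_sum_swap]. *)
Lemma leaf_count_singleton_rcons ts c : 1 < size ts ->
  leaf_count singleton_leaf (rcons ts c) = leaf_count singleton_leaf ts + 0.
Proof.
move=> ts_large; have size_ts : size ts == 1 = false.
  by case: (size ts) ts_large => [|[]].
have size_add : size (rcons ts c) == 1 = false.
  by rewrite size_rcons; case: (size ts) ts_large.
rewrite leaf_count_rcons => [|i _]; rewrite /singleton_leaf size_add ?size_ts.
  by rewrite andbF.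
by rewrite !andbF.
Qed.

Lemma leaf_count_elder_twin_rcons ts c : 1 < size ts ->
  leaf_count elder_twin_leaf (rcons ts c) = leaf_count elder_twin_leaf ts + 0.
Proof.
move=> ts_large; rewrite leaf_count_rcons => [|i lt_i].
  by rewrite /elder_twin_leaf andbCA; case: (size ts) ts_large.
by rewrite /elder_twin_leaf !leaf_at_rcons.
Qed.

Lemma leaf_count_elder_non_twin_rcons ts c : 1 < size ts ->
  leaf_count elder_non_twin_leaf (rcons ts c) =
  leaf_count elder_non_twin_leaf ts + 0.
Proof.
move=> ts_large; rewrite leaf_count_rcons => [|i lt_i].
  by rewrite /elder_non_twin_leaf andbCA; case: (size ts) ts_large.
rewrite /elder_non_twin_leaf !leaf_at_rcons // size_rcons.
by rewrite ltnS ts_large ltnW.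
Qed.

Lemma leaf_count_second_rcons ts c : 1 < size ts ->
  leaf_count second_leaf (rcons ts c) = leaf_count second_leaf ts + 0.
Proof.
move=> ts_large; rewrite leaf_count_rcons => [|i lt_i].
  by rewrite /second_leaf andbC; case: (size ts) ts_large => [|[]].
by rewrite /second_leaf leaf_at_rcons.
Qed.

Lemma leaf_count_younger_rcons ts c : 1 < size ts ->
  leaf_count younger_leaf (rcons ts c) =
  leaf_count younger_leaf ts + nilp (children c).
Proof.
move=> ts_large; rewrite leaf_count_rcons => [|i lt_i].
  by rewrite /younger_leaf leaf_at_last ts_large andbT.
by rewrite /younger_leaf leaf_at_rcons.
Qed.

Theorem theorem3p1 (n : nat) (hn : n <> 1) :
  exists Phi : tip_tree n -> tip_tree n,
    involutive Phi /\
    forall T : tip_tree n,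
      [/\ num_leaves singleton_leaf (sval (Phi T)) =
            num_leaves elder_non_twin_leaf (sval T),
          num_leaves elder_non_twin_leaf (sval (Phi T)) =
            num_leaves singleton_leaf (sval T),
          num_leaves elder_twin_leaf (sval (Phi T)) =
            num_leaves elder_twin_leaf (sval T),
          num_leaves second_leaf (sval (Phi T)) =
            num_leaves second_leaf (sval T) &
          num_leaves younger_leaf (sval (Phi T)) =
            num_leaves younger_leaf (sval T)].
Proof.
have swap_tip (t : plane_tree) : tip_augmented t && (num_edges t == n) ->
    tip_augmented (tree_swap t) && (num_edges (tree_swap t) == n).
  case/andP=> t_tip /eqP tn.
  by rewrite tip_augmented_tree_swap // num_edges_tree_swap ?tn ?eqxx.
exists (fun T => exist _ (tree_swap (sval T)) (swap_tip _ (svalP T))); split.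
  move=> [t t_tip]; apply: eq_exist_uncurried => /=.
  have /andP[t_tip' _] := t_tip.
  by exists (tree_swapK t_tip'); apply: bool_irrelevance.
case=> t /= /andP[t_tip /eqP tn].
have t_edges : num_edges t <> 1 by rewrite tn.
split.
(* For [c] interior, [[:: leaf; c]] has one elder non-twin leaf and no singleton leaf, while
   [[:: leaf]] has the reverse. *)
- apply: (vertex_sum_tree_swap (d := fun=> 0) _ _ _
    leaf_count_elder_non_twin_rcons leaf_count_singleton_rcons) => //;
  by case=> -[].
- apply: (vertex_sum_tree_swap (d := fun=> 0) _ _ _
    leaf_count_singleton_rcons leaf_count_elder_non_twin_rcons) => //;
  by case=> -[].
- apply: (vertex_sum_tree_swap (d := fun=> 0) _ _ _
    leaf_count_elder_twin_rcons leaf_count_elder_twin_rcons) => //;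
  by case=> -[].
- apply: (vertex_sum_tree_swap (d := fun=> 0) _ _ _
    leaf_count_second_rcons leaf_count_second_rcons) => //;
  by case=> -[].
(* A child added after two others is a younger leaf exactly when it is a leaf. *)
- apply: (vertex_sum_tree_swap (d := nat_of_bool) _ _ _
    leaf_count_younger_rcons leaf_count_younger_rcons) => //;
  by case=> -[].
Qed.
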